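(* Let $R$ be a Noetherian ring and $I\subset R$ be an ideal generated by $m$ elements. Then the following hold: (a) $I^{m-j}\subseteq \mathrm{Fitt}_j(I)$ for all $1\le j\le m$. Equality holds, if $I$ is generated by a regular sequence, or $R$ is local with maximal ideal $\mathfrak m$ and $I=\mathfrak m$. (b) If $\mathrm{grade}\, I=j+1$, then $\mathrm{Fitt}_{j}(I)\subseteq I$.
   Context: Rings are commutative with unit. For a finitely generated module $M$ over a Noetherian ring $R$, choose a finite free presentation $G\to F\to M\to 0$ with $\mathrm{rank}\,F=r$, and let $A$ be a matrix representing $G\to F$. The $j$th Fitting ideal of $M$ is $\mathrm{Fitt}_j(M)=I_{r-j}(A)$, where $I_t(A)$ is the ideal generated by the $t$-minors of $A$, with $I_t(A)=R$ for $t\le 0$. This is independent of the choices. An ideal $I$ is regarded as an $R$-module. $\mathrm{grade}\,I$ is the length of a maximal $R$-regular sequence contained in $I$. $I^0=R$.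
   Formalization: Equality in (a) is stated with m the length of the regular sequence, or with m the minimal number of generators of the maximal ideal; for arbitrary m it fails, e.g. I=(x) in k[[x]], m=2, j=1, where Fitt_1(I)=R but I^1=(x). *)

(* Defs.v *)
From HB Require Import structures.
From mathcomp Require Import all_boot all_order all_algebra.
From mathcomp Require Import boolp classical_sets.

Set Implicit Arguments.
Unset Strict Implicit.
Unset Printing Implicit Defensive.

Import GRing.Theory.
Local Open Scope ring_scope.
Local Open Scope classical_set_scope.

(* Ideals are Prop-valued subsets and need not be proper. The zero ring is
   allowed (comPzRingType). *)
Definition is_ideal (R : comPzRingType) (I : set R) : Prop :=
  [/\ I 0, forall x y, I x -> I y -> I (x + y) & forall a x, I x -> I (a * x)].

Record ideal (R : comPzRingType) := Ideal {
  ideal_set :> set R;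
  idealP : is_ideal ideal_set
}.

Definition ideal_gen (R : comPzRingType) (A : set R) : set R :=
  smallest (@is_ideal R) A.

Definition ideal_span (R : comPzRingType) (s : seq R) : set R :=
  ideal_gen [set` s].

Definition ideal_pow (R : comPzRingType) (I : set R) (n : nat) : set R :=
  ideal_gen [set x | exists2 f : 'I_n -> R,
                       (forall i, I (f i)) & x = \prod_(i < n) f i].

Definition generated_by (R : comPzRingType) (I : set R) (m : nat) : Prop :=
  exists2 s : seq R, size s = m & I = ideal_span s.

Definition noetherian (R : comPzRingType) : Prop :=
  forall I : set R, is_ideal I -> exists m, generated_by I m.

Definition maximal_ideal (R : comPzRingType) (I : set R) : Prop :=
  [/\ is_ideal I, I <> setT &
      forall J, is_ideal J -> I `<=` J -> J = I \/ J = setT].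

Definition local_with_maximal_ideal (R : comPzRingType) (I : set R) : Prop :=
  maximal_ideal I /\ forall J, maximal_ideal J -> J = I.

Definition regular_seq (R : comPzRingType) (s : seq R) : Prop :=
  (forall k, (k < size s)%N -> forall x,
     ideal_span (take k s) (s`_k * x) -> ideal_span (take k s) x)
  /\ ideal_span s <> setT.

Definition has_grade (R : comPzRingType) (I : set R) (n : nat) : Prop :=
  exists s : seq R,
    [/\ size s = n, [set` s] `<=` I, regular_seq s &
        forall x, I x -> ~ regular_seq (rcons s x)].

(* An ideal as an R-module: the subtype of elements of I, with the
   submodule structure inherited from the regular module R^o. *)
Section IdealModule.
Variables (R : comPzRingType) (I : ideal R).

Definition ideal_pred : {pred R^o} := fun x => `[< ideal_set I x >].

Fact ideal_pred_submod_closed : submod_closed ideal_pred.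
Proof.
case: (idealP I) => I0 ID IM; split; first exact/asboolP.
move=> a x y /asboolP Ix /asboolP Iy; apply/asboolP.
by apply: ID => //; apply: IM.
Qed.

HB.instance Definition _ :=
  GRing.isSubmodClosed.Build R R^o ideal_pred ideal_pred_submod_closed.

Definition ideal_module : Type := {x : R^o | x \in ideal_pred}.

HB.instance Definition _ := SubChoice.on ideal_module.
HB.instance Definition _ := [SubChoice_isSubLmodule of ideal_module by <:].

End IdealModule.

(* Matrices act on row vectors: the rows of A are the relations. *)
Definition presents (R : comPzRingType) (M : lmodType R) (s r : nat)
    (A : 'M[R]_(s, r)) : Prop :=
  exists phi : {linear 'rV[R]_r -> M},
    (forall x : M, exists v, phi v = x) /\
    (forall v, phi v = 0 <-> exists w : 'rV[R]_s, v = w *m A).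

(* For t = 0 the only minor is the empty determinant 1, so I_0(A) = R. *)
Definition minors_ideal (R : comPzRingType) (s r : nat) (t : nat)
    (A : 'M[R]_(s, r)) : set R :=
  ideal_gen [set x | exists (f : 'I_t -> 'I_s) (g : 'I_t -> 'I_r),
    [/\ {homo f : i k / (i < k)%N}, {homo g : i k / (i < k)%N} &
        x = \det (mxsub f g A)]].

(* A chosen finite free presentation of M; the default 0 x 0 matrix is only
   reached when M is not finitely presented. *)
Definition some_presentation (R : comPzRingType) (M : lmodType R) :
    {p : nat * nat & 'M[R]_(p.1, p.2)} :=
  xget (existT (fun p : nat * nat => 'M[R]_(p.1, p.2)) (0, 0)%N 0)
       [set P | presents M (projT2 P)].

(* The truncated subtraction yields I_0(A) = R when j >= r, in accordance with
   the convention I_t(A) = R for t <= 0. *)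
Definition Fitt (R : comPzRingType) (j : nat) (M : lmodType R) : set R :=
  let P := some_presentation M in minors_ideal ((projT1 P).2 - j) (projT2 P).

(* Main.v *)
Require Import Defs.
From HB Require Import structures.
From mathcomp Require Import all_boot all_order all_algebra.
From mathcomp Require Import boolp classical_sets.
From mathcomp Require Import fingroup perm.

(** Let [x] be a column of [m] generators of [I], and let [A] be a matrix whose
    rows span the relations [v *m x = 0]. Since Fitting ideals do not depend on
    the presentation ([presents_minors]), [Fitt_j(I)] is the ideal of
    [(m - j)]-minors of [A] ([Fitt_ideal]), and every assertion is about these
    minors.

    For [I^(m-j) <= Fitt_j(I)], a monomial of degree [t = m - j < m] in the
    generators is itself a [t]-minor of a matrix of trivial relations
    [x_p e_q - x_q e_p]: if each factor [x_p] is matched with a new index [q]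
    that comes later than [p] in a suitable order of the generators, the matrix
    becomes triangular with the factors of the monomial on its diagonal
    ([koszul_minor]). Conversely, if all relations have their coefficients in
    [I], the entries of [A] lie in [I] and its [t]-minors in [I^t]. This is so
    when the generators form a regular sequence ([regular_relations]), and when
    [I] is the maximal ideal of a local ring and [m] is minimal, as a unit
    coefficient would make a generator redundant ([local_minimal_relations]).

    Suppose now that [I] contains a regular sequence [y_0, ..., y_j], and that
    [j <= m]. The wedge product of [t = m - j] relations is a cycle of degree [t]
    in the Koszul complex of [x], and the Koszul homology vanishes in degrees
    above [m - (j + 1)]. The cycle is therefore a boundary, so that its
    coefficients, which are the maximal minors of the chosen relations, lie in
    [I]. The case [m < j] reduces to [j = m], where the only minor is the empty
    one.

    The exterior algebra is avoided as follows. An element of degree [t] is given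
    by its complementary minors, that is, by the function which maps a word [s]
    of [j] rows to the determinant [rows_det (u ++ s)], where [u] lists the
    relations. Pick rows [c_k] with [c_k *m x = y_k]. One shows by descending
    induction on [k] that [s |-> rows_det (u ++ [c_0; ...; c_(k-1)] ++ s)] is a
    Koszul boundary modulo [(y_0, ..., y_(k-1))]
    ([regular_rows_det_boundary]). The case [k = 0] is the claim. *)

Set Implicit Arguments.
Unset Strict Implicit.
Unset Printing Implicit Defensive.

Import GRing.Theory.
Local Open Scope ring_scope.
Local Open Scope classical_set_scope.

(** * Ideals *)

Section Ideals.
Variable R : comPzRingType.
Implicit Types (J : set R) (s : seq R).

Lemma ideal_gen_ideal (A : set R) : is_ideal (ideal_gen A).
Proof.
split=> [J [[J0 _ _] _]|x y Ax Ay J HJ|a x Ax J HJ] //.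
  by case: (HJ) => [[_ JD _] _]; apply: JD; [apply: Ax|apply: Ay].
by case: (HJ) => [[_ _ JM] _]; apply: JM; apply: Ax.
Qed.

Lemma ideal_gen_mem (A : set R) x : A x -> ideal_gen A x.
Proof. exact: sub_gen_smallest. Qed.

Lemma ideal_gen_sub (A : set R) J :
  is_ideal J -> A `<=` J -> ideal_gen A `<=` J.
Proof. exact: smallest_sub. Qed.

Section Closure.
Variables (J : set R) (idJ : is_ideal J).

Lemma ideal0 : J 0. Proof. by case: idJ. Qed.

Lemma idealD x y : J x -> J y -> J (x + y).
Proof. by case: idJ => _ JD _; apply: JD. Qed.

Lemma idealMl a x : J x -> J (a * x).
Proof. by case: idJ => _ _ JM; apply: JM. Qed.

Lemma idealMr x a : J x -> J (x * a).
Proof. by rewrite mulrC; apply: idealMl. Qed.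

Lemma idealN x : J x -> J (- x).
Proof. by rewrite -mulN1r; apply: idealMl. Qed.

Lemma idealB x y : J x -> J y -> J (x - y).
Proof. by move=> Jx Jy; apply: idealD => //; apply: idealN. Qed.

Lemma ideal_sum (T : Type) (r : seq T) (P : pred T) (F : T -> R) :
  (forall i, P i -> J (F i)) -> J (\sum_(i <- r | P i) F i).
Proof. by move=> JF; apply: big_ind => //; [exact: ideal0|exact: idealD]. Qed.

Lemma ideal1_full : J 1 -> J = setT.
Proof.
by move=> J1; apply/seteqP; split=> // x _; rewrite -(mulr1 x); apply: idealMl.
Qed.

End Closure.

Lemma ideal_spanP s x :
  ideal_span s x <-> exists c : 'I_(size s) -> R, x = \sum_i c i * s`_i.
Proof.
split=> [sx|[c ->]]; last first.
  apply: (ideal_sum (ideal_gen_ideal _)) => i _.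
  apply: (idealMl (ideal_gen_ideal _)); apply: ideal_gen_mem.
  exact: mem_nth.
apply: (sx [set y | exists c : 'I_(size s) -> R, y = \sum_i c i * s`_i]).
split; first split.
- by exists (fun=> 0); rewrite big1 // => i _; rewrite mul0r.
- move=> _ _ [c ->] [d ->]; exists (fun i => c i + d i).
  by rewrite -big_split; apply: eq_bigr => i _; rewrite mulrDl.
- move=> a _ [c ->]; exists (fun i => a * c i).
  by rewrite mulr_sumr; apply: eq_bigr => i _; rewrite mulrA.
move=> y ys; have lt_y : (index y s < size s)%N by rewrite index_mem.
exists (fun i => (i == Ordinal lt_y)%:R).
rewrite (bigD1 (Ordinal lt_y)) //= eqxx mul1r nth_index // big1 ?addr0 //.
by move=> i /negPf ->; rewrite mul0r.
Qed.

Lemma ideal_span_nth s (i : 'I_(size s)) : ideal_span s s`_i.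
Proof. by apply: ideal_gen_mem; apply: mem_nth. Qed.

Lemma ideal_span_nil : ideal_span [::] = [set (0 : R)].
Proof.
apply/seteqP; split=> [x /ideal_spanP[c ->]|x ->]; first by rewrite big_ord0.
by apply: ideal0; apply: ideal_gen_ideal.
Qed.

Lemma ideal_span_rcons s a x :
  ideal_span (rcons s a) x <-> exists c, ideal_span s (x - c * a).
Proof.
split.
  apply: (@ideal_gen_sub _ [set y | exists c, ideal_span s (y - c * a)]).
    have idS := ideal_gen_ideal [set` s].
    split.
    - by exists 0; rewrite mul0r subr0; apply: (ideal0 idS).
    - move=> y z [c Hc] [d Hd]; exists (c + d).
      by rewrite mulrDl opprD addrACA; apply: (idealD idS).
    - move=> b y [c Hc]; exists (b * c).
      by rewrite -mulrA -mulrBr; apply: (idealMl idS).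
  move=> y /=; rewrite mem_rcons inE => /orP[/eqP->|sy].
    by exists 1; rewrite mul1r subrr; apply: ideal0; apply: ideal_gen_ideal.
  by exists 0; rewrite mul0r subr0; apply: ideal_gen_mem.
have idS := ideal_gen_ideal [set` rcons s a].
move=> [c Hc]; rewrite -(subrK (c * a) x); apply: (idealD idS); last first.
  by apply: (idealMl idS); apply: ideal_gen_mem => /=; rewrite mem_rcons mem_head.
apply: (@ideal_gen_sub _ _ idS _ _ Hc) => y sy; apply: ideal_gen_mem.
by rewrite /= mem_rcons inE [y \in s]sy orbT.
Qed.

Definition weakly_regular s : Prop :=
  forall k, (k < size s)%N -> forall x,
    ideal_span (take k s) (s`_k * x) -> ideal_span (take k s) x.

Lemma weakly_regular_rcons s a : weakly_regular (rcons s a) ->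
  weakly_regular s /\ (forall x, ideal_span s (a * x) -> ideal_span s x).
Proof.
rewrite /weakly_regular size_rcons => reg; split=> [k lt_k|].
  have := reg k (ltnW lt_k); rewrite nth_rcons lt_k -cats1 takel_cat //.
  exact: ltnW.
by have := reg (size s) (ltnSn _); rewrite nth_rcons ltnn eqxx -cats1 take_size_cat.
Qed.

End Ideals.

(** * Ideals of minors *)

Section Minors.
Variable R : comPzRingType.

Lemma minors_ideal_is_ideal s r t (A : 'M[R]_(s, r)) :
  is_ideal (minors_ideal t A).
Proof. exact: ideal_gen_ideal. Qed.

Lemma injective_sortP t s (f : 'I_t -> 'I_s) : injective f ->
  exists (f' : 'I_t -> 'I_s) (p : 'S_t),
    {homo f' : i k / (i < k)%N} /\ forall i, f i = f' (p i).
Proof.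
move=> injf.
pose le_s := fun i j : 'I_s => (i <= j)%N.
have le_tr : transitive le_s by move=> ? ? ?; apply: leq_trans.
have le_tot : total le_s by move=> ? ?; apply: leq_total.
pose u := sort_tuple le_s [tuple f i | i < t].
have : perm_eq [tuple f i | i < t] u by rewrite perm_sym perm_sort.
case/tuple_permP => p Ep; exists (tnth u), p; split; last first.
  move=> i; have /val_inj Et : val [tuple f i | i < t] =
    val [tuple tnth u (p i) | i < t] by [].
  by have := congr1 (fun w => tnth w i) Et; rewrite !tnth_mktuple.
move=> i k lt_ik; have x0 := f i.
have u_uniq : uniq u by rewrite sort_uniq map_inj_uniq // enum_uniq.
rewrite ltn_neqAle; apply/andP; split.
  apply/eqP => /val_inj E; move: lt_ik.
  by rewrite (tuple_uniqP _ u_uniq _ _ E) ltnn.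
rewrite !(tnth_nth x0).
have homu := sorted_ltn_nth le_tr x0 (sort_sorted le_tot [tuple f i | i < t]).
by apply: (homu i k _ _ lt_ik); rewrite inE size_sort size_tuple.
Qed.

(** Reordering the chosen rows or columns changes a minor by a sign, and a
    repetition makes it vanish, so the index maps need not be increasing. *)
Lemma minor_mem s r t (A : 'M[R]_(s, r)) (f : 'I_t -> 'I_s) (g : 'I_t -> 'I_r) :
  minors_ideal t A (\det (mxsub f g A)).
Proof.
have idA := minors_ideal_is_ideal t A.
have [/injectiveP injf|/injectivePn[i [k ne_ik Ef]]] := boolP (injectiveb f);
  last first.
  rewrite (determinant_alternate ne_ik); first exact: (ideal0 idA).
  by move=> l; rewrite !mxE Ef.
have [/injectiveP injg|/injectivePn[i [k ne_ik Eg]]] := boolP (injectiveb g);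
  last first.
  rewrite -det_tr (determinant_alternate ne_ik); first exact: (ideal0 idA).
  by move=> l; rewrite !mxE Eg.
have [f' [p [homf' Ef]]] := injective_sortP injf.
have [g' [q [homg' Eg]]] := injective_sortP injg.
have -> : mxsub f g A = row_perm p (col_perm q (mxsub f' g' A)).
  by apply/matrixP => i k; rewrite !mxE Ef Eg.
rewrite row_permE col_permE !det_mulmx.
apply: (idealMl idA); apply: (idealMr idA); apply: ideal_gen_mem.
by exists f', g'.
Qed.

Lemma minors_ideal_sub s r t (A : 'M[R]_(s, r)) (J : set R) : is_ideal J ->
  (forall (f : 'I_t -> 'I_s) (g : 'I_t -> 'I_r), J (\det (mxsub f g A))) <->
  minors_ideal t A `<=` J.
Proof.
move=> idJ; split=> [JA|AJ f g]; last by apply: AJ; apply: minor_mem.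
by apply: ideal_gen_sub => // x [f [g [_ _ ->]]].
Qed.

Lemma minors_ideal_tr s r t (A : 'M[R]_(s, r)) :
  minors_ideal t A^T `<=` minors_ideal t A.
Proof.
apply/minors_ideal_sub => [|f g]; first exact: minors_ideal_is_ideal.
by rewrite -trmx_mxsub det_tr; apply: minor_mem.
Qed.

(** Each row of [B *m A] is a combination of rows of [A]. *)
Lemma det_mulmx_rows t s (B : 'M[R]_(t, s)) (A : 'M[R]_(s, t)) :
  \det (B *m A) =
  \sum_(h : {ffun 'I_t -> 'I_s}) (\prod_i B i (h i)) * \det (rowsub h A).
Proof.
rewrite /determinant.
under eq_bigr => p _.
  under eq_bigr do rewrite mxE.
  rewrite bigA_distr_bigA mulr_sumr.
  over.
rewrite exchange_big; apply: eq_bigr => h _ /=.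
rewrite mulr_sumr; apply: eq_bigr => p _.
rewrite big_split /= mulrCA; congr (_ * (_ * _)).
by apply: eq_bigr => i _; rewrite mxE.
Qed.

Lemma minors_ideal_mull s' s r t (B : 'M[R]_(s', s)) (A : 'M[R]_(s, r)) :
  minors_ideal t (B *m A) `<=` minors_ideal t A.
Proof.
have idA := minors_ideal_is_ideal t A.
apply/minors_ideal_sub => // f g.
rewrite mxsub_mul det_mulmx_rows; apply: (ideal_sum idA) => h _.
apply: (idealMl idA).
have -> : rowsub h (colsub g A) = mxsub h g A by apply/matrixP => i k; rewrite !mxE.
exact: minor_mem.
Qed.

Lemma minors_ideal_mulr s r r' t (A : 'M[R]_(s, r)) (B : 'M[R]_(r, r')) :
  minors_ideal t (A *m B) `<=` minors_ideal t A.
Proof.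
rewrite -[A *m B]trmxK trmx_mul.
apply: subset_trans (@minors_ideal_tr _ _ _ _) _.
apply: subset_trans (@minors_ideal_mull _ _ _ _ _ _) _.
exact: minors_ideal_tr.
Qed.

Lemma minors_ideal_anti s r t t' (A : 'M[R]_(s, r)) : (t <= t')%N ->
  minors_ideal t' A `<=` minors_ideal t A.
Proof.
move=> /subnK <-; elim: (t' - t)%N => [|d IH] //; rewrite addSn.
apply: subset_trans IH; have idA := minors_ideal_is_ideal (d + t) A.
apply/minors_ideal_sub => // f g; rewrite (expand_det_row _ ord0).
apply: (ideal_sum idA) => k _; apply: (idealMl idA); apply: (idealMl idA).
have -> : row' ord0 (col' k (mxsub f g A)) = mxsub (f \o lift ord0) (g \o lift k) A.
  by apply/matrixP => i l; rewrite !mxE.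
exact: minor_mem.
Qed.

(** A Laplace expansion along a row that comes from [B] lowers the size of the
    minor by one, and a minor has at most [k] such rows. The induction is on a
    bound [d] for their number. *)
Lemma minors_ideal_col_mx s k r t (A : 'M[R]_(s, r)) (B : 'M[R]_(k, r)) :
  minors_ideal t (col_mx A B) `<=` minors_ideal (t - k) A.
Proof.
suff H d n (f : 'I_n -> 'I_(s + k)) (g : 'I_n -> 'I_r) :
    (\sum_i (s <= f i) <= d)%N ->
    minors_ideal (n - d) A (\det (mxsub f g (col_mx A B))).
  apply: ideal_gen_sub => [|_ [f [g [homf _ ->]]]].
    exact: minors_ideal_is_ideal.
  apply: H; have -> : (\sum_i (s <= f i) = #|[set i | s <= f i]%SET|)%N.
    by rewrite -sum1dep_card [RHS]big_mkcond; apply: eq_bigr => i _; case: leq.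
  rewrite -[k in (_ <= k)%N]card_ord.
  rewrite -(card_imset _ (@rshift_inj s k)).
  have injf : injective f.
    move=> i j Ef; apply/val_inj; case: (ltngtP i j) => // /homf;
    by rewrite Ef ltnn.
  rewrite -(card_imset _ injf); apply/subset_leq_card/fintype.subsetP => y /imsetP[i].
  rewrite inE => le_sf ->; apply/imsetP.
  by case: (split_ordP (f i)) le_sf => [i' ->|i' -> _]; [rewrite /= leqNgt ltn_ord|exists i'].
elim: d n f g => [|d IH] n f g.
  rewrite leqn0 sum_nat_eq0 subn0 => /forallP f_lt.
  have ltf i : (f i < s)%N by move: (f_lt i); rewrite /= eqb0 -ltnNge.
  have -> : mxsub f g (col_mx A B) = mxsub (fun i => Ordinal (ltf i)) g A.
    apply/matrixP => i l; rewrite [RHS]mxE -(col_mxEu A B) [LHS]mxE.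
    by congr (fun_of_matrix _ _ _); apply: val_inj.
  exact: minor_mem.
have [/existsP[i0 le_sf]|/existsPn noi] := boolP [exists i, (s <= f i)%N];
  last first.
  move=> _; apply: (@minors_ideal_anti _ _ _ (n - d)); first by rewrite leq_sub2l.
  by apply: IH; rewrite big1 // => i _; rewrite (negPf (noi i)).
case: n => [|n] in f g i0 le_sf *; first by case: i0 {le_sf}.
rewrite (bigD1_ord i0) //= le_sf add1n ltnS => le_d.
have idA := minors_ideal_is_ideal (n - d) A.
rewrite (expand_det_row _ i0) subSS.
apply: (ideal_sum idA) => l _; apply: (idealMl idA); apply: (idealMl idA).
have -> : row' i0 (col' l (mxsub f g (col_mx A B))) =
    mxsub (f \o lift i0) (g \o lift l) (col_mx A B).
  by apply/matrixP => i j; rewrite !mxE.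
exact: IH.
Qed.

(** A minor of [A] extended by the identity block keeps its determinant. *)
Lemma minors_ideal_block s k r t (A : 'M[R]_(s, r)) (Q : 'M[R]_(k, r)) :
  minors_ideal t A `<=` minors_ideal (t + k) (block_mx A 0 Q 1%:M).
Proof.
apply/minors_ideal_sub => [|f g]; first exact: minors_ideal_is_ideal.
pose ext n (h : 'I_t -> 'I_n) (i : 'I_(t + k)) : 'I_(n + k) :=
  match split i with inl a => lshift k (h a) | inr b => rshift n b end.
rewrite -[\det _]mulr1 -[X in _ * X](det1 R k) -(det_lblock _ (colsub g Q)).
have extl n h i : ext n h (lshift k i) = lshift k (h i).
  by rewrite /ext (unsplitK (inl i)).
have extr n h i : ext n h (rshift t i) = rshift n i.
  by rewrite /ext (unsplitK (inr i)).
suff <- : mxsub (ext _ f) (ext _ g) (block_mx A 0 Q 1%:M) =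
    block_mx (mxsub f g A) 0 (colsub g Q) 1%:M.
  exact: minor_mem.
apply/matrixP => i l; rewrite mxE.
case: (split_ordP i) => i' ->; case: (split_ordP l) => l' ->;
by rewrite ?extl ?extr ?block_mxEul ?block_mxEur ?block_mxEdl ?block_mxEdr !mxE.
Qed.

End Minors.

(** * Presentations and Fitting ideals *)

Section Presentations.
Variable R : comPzRingType.
Implicit Type M : lmodType R.

Lemma mulmx_lift s p r (A : 'M[R]_(s, r)) (C : 'M[R]_(p, r)) :
  (forall i, exists w : 'rV_p, row i A = w *m C) -> exists W, A = W *m C.
Proof.
move=> /choice[w Hw]; exists (\matrix_i w i).
by apply/row_matrixP => i; rewrite row_mul rowK.
Qed.

(** Free modules are projective. *)
Lemma linear_lift M r r' (phi : {linear 'rV[R]_r -> M})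
    (phi' : {linear 'rV[R]_r' -> M}) :
  (forall x, exists v, phi' v = x) ->
  exists P : 'M_(r, r'), forall v, phi v = phi' (v *m P).
Proof.
move=> surj.
have /choice[p Hp] i : exists v, phi' v = phi (delta_mx 0 i) by apply: surj.
exists (\matrix_i p i) => v.
rewrite mulmx_sum_row !linear_sum [v in LHS]row_sum_delta linear_sum.
by apply: eq_bigr => i _; rewrite !linearZ rowK Hp.
Qed.

(** With [phi = phi' P] and [phi' = phi Q], the relations of the two generating
    families taken together are spanned both by the rows of
    [[A, 0], [-Q, 1]] and by the rows of [[1, -P], [0, B]]; in either
    presentation the identity block accounts for the redundant generators. *)
Lemma presents_minors M s r s' r' (A : 'M[R]_(s, r)) (B : 'M[R]_(s', r')) j :
  presents M A -> presents M B ->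
  minors_ideal (r - j) A `<=` minors_ideal (r' - j) B.
Proof.
move=> [phi [surj ker]] [phi' [surj' ker']].
have [P HP] := linear_lift phi surj'.
have [Q HQ] := linear_lift phi' surj.
pose C := block_mx A 0 (- Q) (1%:M : 'M_r').
pose C' := col_mx (row_mx (1%:M : 'M_r) (- P)) (row_mx 0 B).
have rel (u : 'rV_r) (v : 'rV_r') :
    phi u + phi' v = 0 -> exists w, row_mx u v = w *m C'.
  move=> uv0; have /ker'[w Hw] : phi' (v + u *m P) = 0.
    by rewrite linearD -HP addrC.
  exists (row_mx u w); rewrite mul_row_col !mul_mx_row mulmx1 mulmx0 -Hw.
  by rewrite add_row_mx addr0 mulmxN addrC addrK.
have [W EC] : exists W, C = W *m C'.
  apply: mulmx_lift => i; case: (split_ordP i) => k ->.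
    rewrite rowKu row_row_mx row0; apply: rel; rewrite linear0 addr0.
    by apply/ker; exists (delta_mx 0 k); rewrite rowE.
  rewrite rowKd row_row_mx linearN /=; apply: rel.
  by rewrite linearN HQ row1 -rowE addNr.
apply: subset_trans (@minors_ideal_block _ _ _ _ (r - j) A (- Q)) _.
apply: (@subset_trans _ (minors_ideal (r + r' - j) C)).
  by apply: minors_ideal_anti; rewrite leq_subLR addnA leq_add2r -leq_subLR.
rewrite EC; apply: subset_trans (@minors_ideal_mull _ _ _ _ _ _ _) _.
(* Putting the rows of [B] first turns the identity block into [r] extra rows. *)
have -> : C' = col_mx (row_mx 0 (1%:M : 'M_r)) (row_mx (1%:M : 'M_s') 0) *m
   col_mx (row_mx 0 B) (row_mx (1%:M : 'M_r) (- P)).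
  by rewrite mul_col_mx !mul_row_col !mul1mx !mul0mx add0r addr0.
apply: subset_trans (@minors_ideal_mull _ _ _ _ _ _ _) _.
apply: subset_trans (@minors_ideal_col_mx _ _ _ _ _ _ _) _.
have -> : (r + r' - j - r = r' - j)%N by rewrite subnAC addKn.
have -> : row_mx 0 B = B *m row_mx 0 1%:M :> 'M_(s', r + r').
  by rewrite mul_mx_row mulmx0 mulmx1.
exact: minors_ideal_mulr.
Qed.

Lemma Fitt_presents M s r (A : 'M[R]_(s, r)) j :
  presents M A -> Fitt j M = minors_ideal (r - j) A.
Proof.
move=> MA; rewrite /Fitt.
have : presents M (projT2 (some_presentation M)).
  apply: (@xgetPex _ _ [set P : {p : nat * nat & 'M[R]_(p.1, p.2)} |
     presents M (projT2 P)]).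
  by exists (existT (fun p => 'M[R]_(p.1, p.2)) (s, r) A).
case: (some_presentation M) => [[s' r'] B] /= MB.
apply/seteqP; split; [exact: (presents_minors MB MA)|exact: (presents_minors MA MB)].
Qed.

(** A submodule of a free module of finite rank over a Noetherian ring is
    spanned by the rows of a matrix: lift generators of the ideal of first
    coordinates, and recurse on the vectors with first coordinate 0. *)
Lemma noetherian_span (R_noeth : noetherian R) m (K : set 'rV[R]_m) :
  K 0 -> (forall a u v, K u -> K v -> K (a *: u + v)) ->
  exists s (A : 'M[R]_(s, m)), forall v, K v <-> exists w : 'rV_s, v = w *m A.
Proof.
elim: m K => [|m IH] K K0 KZD.
  exists 0%N, 0 => v; rewrite (thinmx0 v); split=> // _.
  by exists 0; rewrite thinmx0.
have KD u v : K u -> K v -> K (u + v) by move=> *; rewrite -[u]scale1r; apply: KZD.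
have KZ a u : K u -> K (a *: u) by move=> *; rewrite -[_ *: _]addr0; apply: KZD.
have Kmul p (w : 'rV_p) (V : 'M_(p, m.+1)) : (forall i, K (row i V)) -> K (w *m V).
  by move=> KV; rewrite mulmx_sum_row; apply: big_ind => // i _; apply: KZ.
pose L := [set a | exists2 v, K v & v 0 0 = a].
have idL : is_ideal L.
  split; first by exists 0; rewrite ?mxE.
    by move=> _ _ [u Ku <-] [v Kv <-]; exists (u + v); [exact: KD|rewrite mxE].
  by move=> a _ [u Ku <-]; exists (a *: u); [exact: KZ|rewrite mxE].
have [n [g size_g Lg]] := R_noeth L idL.
have /choice[V HV] (i : 'I_(size g)) : exists v, K v /\ v 0 0 = g`_i.
  by have [v ? ?] : L g`_i by [rewrite Lg; apply: ideal_span_nth]; exists v.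
have [||s [A HA]] := IH [set v : 'rV_m | K (row_mx (0 : 'rV_1) v)].
- by rewrite /= row_mx0.
- move=> a u v Ku Kv /=.
  have -> : row_mx 0 (a *: u + v) = a *: row_mx 0 u + row_mx (0 : 'rV_1) v.
    by rewrite scale_row_mx add_row_mx scaler0 addr0.
  exact: KZD.
have KA k : K (row k (row_mx (0 : 'cV_s) A)).
  have -> : row k (row_mx (0 : 'cV_s) A) = row_mx 0 (row k A).
    by rewrite row_row_mx row0.
  by apply/HA; exists (delta_mx 0 k); apply: rowE.
exists (size g + s)%N, (col_mx (\matrix_i V i) (row_mx (0 : 'cV_s) A)) => v.
split=> [Kv|[w ->]]; last first.
  apply: Kmul => i; case: (split_ordP i) => k ->.
    by rewrite rowKu rowK; case: (HV k).
  by rewrite rowKd; apply: KA.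
have /ideal_spanP[c Ec] : ideal_span g (v 0 0) by rewrite -Lg; exists v.
pose cv := \row_i c i.
pose u : 'rV_(1 + m) := v - cv *m \matrix_i V i.
have Ku : K u.
  apply: KD => //; rewrite -scaleN1r; apply: KZ; apply: Kmul => i.
  by rewrite rowK; case: (HV i).
have lu0 : lsubmx u = 0.
  apply/rowP => i; rewrite ord1 !mxE [lshift _ _](_ : _ = 0); last exact: val_inj.
  rewrite Ec -sumrB big1 // => k _.
  by rewrite !mxE; case: (HV k) => _ ->; rewrite subrr.
have Eu : u = row_mx (0 : 'rV_1) (rsubmx u) by rewrite -lu0 hsubmxK.
have /HA[w Hw] : K (row_mx (0 : 'rV_1) (rsubmx u)) by rewrite -Eu.
exists (row_mx cv w); rewrite mul_row_col.
have -> : w *m row_mx (0 : 'cV_s) A = u by rewrite mul_mx_row mulmx0 -Hw -Eu.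
by rewrite addrC subrK.
Qed.

Definition lincomb M m (x : 'I_m -> M) (v : 'rV[R]_m) : M :=
  \sum_i v 0 i *: x i.

Fact lincomb_is_linear M m (x : 'I_m -> M) : linear (lincomb x).
Proof.
move=> a u v; rewrite /lincomb scaler_sumr -big_split; apply: eq_bigr => i _.
by rewrite !mxE scalerDl scalerA.
Qed.

HB.instance Definition _ M m (x : 'I_m -> M) :=
  GRing.isLinear.Build R 'rV[R]_m M *:%R (lincomb x) (lincomb_is_linear x).

(** The generators of an ideal are recorded as a column [x], so that its
    elements are the products [v *m x] and its relations are the rows [v] with
    [v *m x = 0]. *)
Definition generators (I : set R) m (x : 'cV[R]_m) : Prop :=
  forall a, I a <-> exists v : 'rV_m, a = (v *m x) 0 0.

Lemma generators_span (g : seq R) :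
  generators (ideal_span g) (\col_(i < size g) g`_i).
Proof.
move=> a; rewrite ideal_spanP; split=> [[c ->]|[v ->]].
  by exists (\row_i c i); rewrite mxE; apply: eq_bigr => i _; rewrite !mxE.
by exists (v 0); rewrite mxE; apply: eq_bigr => i _; rewrite mxE.
Qed.

Lemma generators_mem (I : set R) m (x : 'cV[R]_m) i :
  generators I x -> I (x i 0).
Proof. by move=> Ix; apply/Ix; exists (delta_mx 0 i); rewrite -rowE mxE. Qed.

Lemma Fitt_ideal (R_noeth : noetherian R) (I : ideal R) m (x : 'cV[R]_m) :
  generators I x ->
  exists s (A : 'M_(s, m)),
    (forall v : 'rV_m, v *m x = 0 <-> exists w : 'rV_s, v = w *m A) /\
    forall j, Fitt j (ideal_module I) = minors_ideal (m - j) A.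
Proof.
move=> Ix.
have [||s [A HA]] := @noetherian_span R_noeth m [set v : 'rV_m | v *m x = 0].
- by rewrite /= mul0mx.
- by move=> a u v /= u0 v0; rewrite mulmxDl -scalemxAl u0 v0 scaler0 addr0.
exists s, A; split=> // j; apply: Fitt_presents.
have xI i : x i 0 \in ideal_pred I by apply/asboolP; apply: generators_mem.
pose y i : ideal_module I := Sub (x i 0) (xI i).
have val_y v : val (lincomb y v) = (v *m x) 0 0.
  by rewrite mxE raddf_sum; apply: eq_bigr => i _.
exists (lincomb y); split=> [z|v].
  have /Ix[v Hv] : ideal_set I (val z) by have /asboolP := valP z.
  by exists v; apply: val_inj; rewrite val_y.
rewrite -HA /=; split=> [vy0|vx0].
  by apply/matrixP => i k; rewrite !ord1 -val_y vy0 mxE.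
by apply: val_inj; rewrite val_y vx0 mxE.
Qed.

End Presentations.

(** * Powers of an ideal against its Fitting ideals *)

Section Powers.
Variable R : comPzRingType.

Lemma ideal_pow_sub (I : set R) m (x : 'cV[R]_m) t (J : set R) :
  generators I x -> is_ideal J ->
  (forall h : 'I_t -> 'I_m, J (\prod_i x (h i) 0)) -> ideal_pow I t `<=` J.
Proof.
move=> Ix idJ Jx; apply: ideal_gen_sub => // _ [f If ->].
have /choice[v Hv] i : exists v : 'rV_m, f i = (v *m x) 0 0 by apply/Ix.
under eq_bigr do rewrite Hv mxE.
rewrite bigA_distr_bigA; apply: (ideal_sum idJ) => h _.
by rewrite big_split; apply: (idealMl idJ).
Qed.

(** Listing each letter of [s] once, by first occurrence, puts the letter at
    position [i] of [s] no later than position [i]. *)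
Lemma first_occurrences (T : eqType) (s : seq T) :
  exists u, [/\ uniq u, u =i s &
    forall x0 i, (i < size s)%N -> (index (nth x0 s i) u <= i)%N].
Proof.
elim/last_ind: s => [|s a [u [u_uniq us Hu]]]; first by exists [::].
have le_us : (size u <= size s)%N by apply: uniq_leq_size => // y; rewrite us.
exists (if a \in u then u else rcons u a); case: ifP => au; split=> //.
- move=> y; rewrite mem_rcons inE us; case: eqP => [->|] //=.
  by rewrite -us.
- move=> x0 i; rewrite size_rcons ltnS nth_rcons => le_i.
  case: ltnP => [/Hu//|ge_i]; have -> : i = size s by apply/eqP; rewrite eqn_leq le_i.
  by rewrite eqxx; apply: leq_trans le_us; rewrite ltnW // index_mem.
- by rewrite rcons_uniq au.
- by move=> y; rewrite !mem_rcons !inE us.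
- move=> x0 i; rewrite size_rcons ltnS nth_rcons -cats1 => le_i.
  case: ltnP => [lt_i|ge_i].
    by rewrite index_cat us mem_nth //; apply: Hu.
  have -> : i = size s by apply/eqP; rewrite eqn_leq le_i.
  by rewrite eqxx index_cat au /= eqxx addn0.
Qed.

(** A degree [t < m] monomial in the generators is a minor of the matrix of
    trivial relations [x_p e_q - x_q e_p]. List the indices so that the [i]-th
    factor [h i] of the monomial stands before the index [g i] at position
    [i.+1]: the relations between [h i] and [g i], restricted to the columns
    [g], form a triangular matrix with diagonal [x (h i) 0]. *)
Lemma koszul_minor m s (x : 'cV[R]_m) (A : 'M[R]_(s, m)) t (h : 'I_t -> 'I_m) :
  (forall v : 'rV_m, v *m x = 0 -> exists w : 'rV_s, v = w *m A) ->
  (t < m)%N -> minors_ideal t A (\prod_i x (h i) 0).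
Proof.
move=> relA lt_tm.
have [u [u_uniq u_mem Hu]] := first_occurrences (codom h ++ enum 'I_m).
have size_u : size u = m.
  rewrite -[RHS]card_ord cardE; apply/perm_size/uniq_perm => //.
    exact: enum_uniq.
  by move=> k; rewrite u_mem mem_cat mem_enum orbT.
have idx_h i : (index (h i) u <= i)%N.
  have lt_i : (i < size (codom h))%N by rewrite size_codom card_ord.
  have := Hu (h i) i; rewrite size_cat nth_cat lt_i ltn_addr //.
  rewrite (nth_map i) ?size_enum_ord // nth_ord_enum; exact.
pose g (i : 'I_t) := nth (h i) u i.+1.
have lt_i1 (i : 'I_t) : (i.+1 < size u)%N.
  by rewrite size_u; apply: leq_ltn_trans lt_tm.
have idx_g i : index (g i) u = i.+1 by rewrite index_uniq.
pose W :=
  \matrix_i (x (h i) 0 *: delta_mx 0 (g i) - x (g i) 0 *: delta_mx 0 (h i) : 'rV_m).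
have [V EW] : exists V, W = V *m A.
  apply: mulmx_lift => i; apply: relA; rewrite rowK.
  rewrite mulmxBl -!scalemxAl -!rowE; apply/matrixP => a b.
  by rewrite !mxE !ord1 mulrC subrr.
apply: (@minors_ideal_mull _ _ _ _ _ V); rewrite -EW.
have <- : \det (mxsub id g W) = \prod_i x (h i) 0; last exact: minor_mem.
have W_gt (i k : 'I_t) : (i <= k)%N -> (g k == h i) = false.
  move=> le_ik; apply: contra_leqF (idx_h i) => /eqP <-.
  by rewrite idx_g ltnS.
rewrite det_trig; last first.
  apply/is_trig_mxP => i k lt_ik; rewrite !mxE !eqxx /= W_gt ?(ltnW lt_ik) //.
  have /negPf -> : g k != g i.
    apply: contraTneq lt_ik => /(congr1 (index^~ u)).
    by rewrite !idx_g => -[->]; rewrite ltnn.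
  by rewrite !mulr0 subrr.
by apply: eq_bigr => i _; rewrite !mxE !eqxx W_gt // mulr1 mulr0 subr0.
Qed.

(** If all relations have their coefficients in [I], the entries of the
    presentation matrix lie in [I], and its [t]-minors in [I^t]. *)
Lemma minors_ideal_pow (I : set R) s r t (A : 'M[R]_(s, r)) :
  (forall i k, I (A i k)) -> minors_ideal t A `<=` ideal_pow I t.
Proof.
move=> IA; have idP : is_ideal (ideal_pow I t) by apply: ideal_gen_ideal.
apply/minors_ideal_sub => // f g; apply: (ideal_sum idP) => p _.
apply: (idealMl idP); apply: ideal_gen_mem.
by exists (fun i => A (f i) (g (p i))) => //; apply: eq_bigr => i _; rewrite mxE.
Qed.

(** Over a regular sequence, the last coefficient of a relation lies in the
    span of the previous terms; substituting it gives a shorter relation. *)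
Lemma regular_relations (s : seq R) : weakly_regular s ->
  forall c : nat -> R, \sum_(i < size s) c i * s`_i = 0 ->
  forall i, (i < size s)%N -> ideal_span s (c i).
Proof.
elim/last_ind: s => [|s a IH] //= /weakly_regular_rcons[reg reg_a] c.
have idS := ideal_gen_ideal [set` s].
have idSa := ideal_gen_ideal [set` rcons s a].
have sub y : ideal_span s y -> ideal_span (rcons s a) y.
  by move=> Sy; apply/ideal_span_rcons; exists 0; rewrite mul0r subr0.
rewrite size_rcons big_ord_recr /= nth_rcons ltnn eqxx.
under eq_bigr do rewrite nth_rcons ltn_ord.
move=> /eqP; rewrite addr_eq0 => /eqP Ec.
have Sc : ideal_span s (c (size s)).
  apply: reg_a; rewrite mulrC -[_ * _]opprK -Ec; apply: (idealN idS).
  by apply: (ideal_sum idS) => i _; apply: (idealMl idS); apply: ideal_span_nth.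
have [d Ed] := (ideal_spanP s _).1 Sc.
pose d' i := oapp d 0 (insub i).
have {}Ed : c (size s) = \sum_(i < size s) d' i * s`_i.
  by rewrite Ed; apply: eq_bigr => i _; rewrite /d' valK.
move=> i; rewrite ltnS leq_eqVlt => /orP[/eqP ->|lt_i]; first exact: sub.
rewrite -[c i](addrK (d' i * a)); apply: (idealB idSa); last first.
  apply: (idealMl idSa); apply: ideal_gen_mem => /=.
  by rewrite mem_rcons mem_head.
apply: sub; apply: (IH reg (fun i => c i + d' i * a)) => //.
under eq_bigr do rewrite mulrDl mulrAC.
by rewrite big_split -mulr_suml -Ed /= Ec addNr.
Qed.

Lemma exists_maximal_ideal (J : set R) : is_ideal J -> ~ J 1 ->
  exists2 K, maximal_ideal K & J `<=` K.
Proof.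
move=> idJ J1.
(* The union of the empty chain is empty, hence the first disjunct. *)
pose P (X : set R) := X = set0 \/ [/\ is_ideal X, J `<=` X & ~ X 1].
have [F FP Ftot|K [PK maxK]] := @Zorn_bigcup _ P.
  have [[X FX X0]|noX] := pselect (exists2 X, F X & X <> set0); last first.
    left; apply/seteqP; split=> // y [X FX Xy].
    by exfalso; apply: noX; exists X => // X0; rewrite X0 in Xy.
  have FPX Y y : F Y -> Y y -> [/\ is_ideal Y, J `<=` Y & ~ Y 1].
    by move=> /FP[->|].
  have [//|[idX JX X1]] := FP X FX.
  right; split; last by move=> [Y FY Y1]; have [] := FPX _ _ FY Y1.
    split; first by exists X => //; apply: (ideal0 idX).
      move=> y z [Y FY Yy] [Z FZ Zz].
      have [idY _ _] := FPX _ _ FY Yy; have [idZ _ _] := FPX _ _ FZ Zz.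
      have [YZ|ZY] := Ftot _ _ FY FZ.
        by exists Z => //; apply: (idealD idZ) => //; apply: YZ.
      by exists Y => //; apply: (idealD idY) => //; apply: ZY.
    move=> a y [Y FY Yy]; exists Y => //.
    by have [idY _ _] := FPX _ _ FY Yy; apply: (idealMl idY).
  by move=> y Jy; exists X => //; apply: (JX y).
have [idK JK K1] : [/\ is_ideal K, J `<=` K & ~ K 1].
  case: PK => // K0; exfalso; apply: (maxK J); last by right; split.
  split; first by rewrite K0.
  by move=> /(_ _ (ideal0 idJ)); rewrite K0.
exists K => //; split=> // [KT|L idL KL]; first by apply: K1; rewrite KT.
have [L1|L1] := pselect (L 1); [right; exact: ideal1_full|left].
apply: contrapT => neLK; apply: (maxK L); last first.
  by right; split=> // y /JK /KL.
by split=> // LK; apply: neLK; apply/seteqP.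
Qed.

Lemma local_unit (I : set R) a :
  local_with_maximal_ideal I -> ~ I a -> exists b, b * a = 1.
Proof.
move=> [_ maxI] nIa; have idA := ideal_gen_ideal [set a].
have [A1|A1] := pselect (ideal_gen [set a] 1).
  apply: (A1 [set y | exists b, b * a = y]); split; last first.
    by move=> _ ->; exists 1; rewrite mul1r.
  split; first by exists 0; rewrite mul0r.
    by move=> _ _ [b <-] [c <-]; exists (b + c); rewrite mulrDl.
  by move=> c _ [b <-]; exists (c * b); rewrite mulrA.
have [K maxK AK] := exists_maximal_ideal idA A1.
exfalso; apply: nIa; rewrite -(maxI K maxK); apply: AK.
exact: ideal_gen_mem.
Qed.

(** A relation with a unit coefficient would make a generator redundant. *)
Lemma local_minimal_relations (I : set R) m (x : 'cV[R]_m) :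
  generators I x -> local_with_maximal_ideal I ->
  (forall n, generated_by I n -> (m <= n)%N) ->
  forall v : 'rV_m, v *m x = 0 -> forall i, I (v 0 i).
Proof.
move=> Ix Iloc min_m v vx0 i; apply: contrapT => nIv.
have [b bv1] := local_unit Iloc nIv.
pose g := [seq x k 0 | k <- rem i (enum 'I_m)].
have idS := ideal_gen_ideal [set` g].
have gx k : k != i -> ideal_span g (x k 0).
  move=> ne_k; apply: ideal_gen_mem; apply: map_f.
  by rewrite mem_rem_uniq ?enum_uniq // !inE ne_k mem_enum.
have gxi : ideal_span g (x i 0).
  rewrite -[x i 0]mul1r -bv1 -mulrA; apply: (idealMl idS).
  have : (v *m x) 0 0 = 0 by rewrite vx0 mxE.
  rewrite mxE (bigD1 i) //= => /eqP; rewrite addr_eq0 => /eqP ->.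
  by apply: (idealN idS); apply: (ideal_sum idS) => k ?; apply: (idealMl idS); apply: gx.
have : generated_by I m.-1.
  exists g; first by rewrite size_map size_rem ?mem_enum // size_enum_ord.
  apply/seteqP; split=> [y /Ix[w ->]|].
    rewrite mxE; apply: (ideal_sum idS) => k _; apply: (idealMl idS).
    by have [->|/gx] := eqVneq k i.
  have idI : is_ideal I by case: Iloc => -[].
  apply: ideal_gen_sub => // _ /mapP[k _ ->]; exact: generators_mem.
move/min_m; rewrite leqNgt ltn_predL => /negP; apply.
exact: leq_ltn_trans (ltn_ord i).
Qed.

End Powers.

(** * Koszul cycles of large degree *)

Section Boundary.
Variables (R : comPzRingType) (T : eqType) (w : T -> R).
Implicit Types (d : seq T -> R) (L s u : seq T).

(** The Koszul differential of a cochain on words: the alternating sum of the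
    [w a * d (word without a)] over the positions of the letters [a]. Cochains
    on all words, not only alternating ones, already satisfy
    [koszul_boundary_boundary]. *)
Fixpoint koszul_boundary d L : R :=
  if L is b :: s then w b * d s - koszul_boundary (fun s' => d (b :: s')) s
  else 0.
Local Notation bd := koszul_boundary.

Lemma koszul_boundaryB d e L : bd (fun s => d s - e s) L = bd d L - bd e L.
Proof.
elim: L d e => [|b s IH] d e /=; first by rewrite subr0.
by rewrite IH mulrBr opprD addrACA -opprD.
Qed.

Lemma koszul_boundaryZ d a L : bd (fun s => a * d s) L = a * bd d L.
Proof.
elim: L d => [|b s IH] d /=; first by rewrite mulr0.
by rewrite IH mulrBr mulrCA.
Qed.

Lemma koszul_boundary_boundary d L : bd (bd d) L = 0.
Proof.
elim: L d => [|b s IH] d //=.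
by rewrite koszul_boundaryB koszul_boundaryZ IH subr0 subrr.
Qed.

Lemma koszul_boundary_mem (J : set R) d L : is_ideal J ->
  (forall s, (size s).+1 = size L -> J (d s)) -> J (bd d L).
Proof.
move=> idJ; elim: L d => [|b s IH] d Jd /=; first exact: (ideal0 idJ).
apply: (idealB idJ); first by apply: (idealMl idJ); apply: Jd.
by apply: IH => s' Es'; apply: Jd; rewrite /= Es'.
Qed.

Lemma koszul_boundary_weight (J : set R) d L : is_ideal J ->
  (forall b, J (w b)) -> J (bd d L).
Proof.
move=> idJ Jw; elim: L d => [|b s IH] d /=; first exact: (ideal0 idJ).
by apply: (idealB idJ) => //; apply: (idealMr idJ).
Qed.

(** The terms that delete a letter of [u] are multiples of its weight; what
    remains is, up to sign, the boundary over [s]. *)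
Lemma koszul_boundary_cat (J : set R) d u s : is_ideal J ->
  (forall b, b \in u -> J (w b)) -> J (bd d (u ++ s)) ->
  J (bd (fun s' => d (u ++ s')) s).
Proof.
move=> idJ; elim: u d => [|b u IH] d Ju //= Jbd.
apply: (IH (fun s' => d (b :: s'))) => [a ua|].
  by apply: Ju; rewrite inE ua orbT.
rewrite -[bd _ _](subKr (w b * d (u ++ s))); apply: (idealB idJ) => //.
by apply: (idealMr idJ); apply: Ju; rewrite mem_head.
Qed.

Lemma koszul_boundary_sum d L n x0 : size L = n ->
  bd d L =
  \sum_(i < n) (-1) ^+ i * (w (nth x0 L i) * d (take i L ++ drop i.+1 L)).
Proof.
elim: L n d => [|b s IH] n d <- /=; first by rewrite big_ord0.
rewrite big_ord_recl expr0 mul1r /= drop0 (IH _ _ erefl) -sumrN.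
congr (_ + _); apply: eq_bigr => i _.
by rewrite /bump add1n exprS mulN1r mulNr.
Qed.

End Boundary.

Section KoszulCycles.
Variables (R : comPzRingType) (m : nat) (x : 'cV[R]_m).
Implicit Types (L c s u : seq 'rV[R]_m).

Definition weight (v : 'rV[R]_m) : R := (v *m x) 0 0.

Definition rows_det L : R := \det (\matrix_(i < m) nth 0 L i).

(** Adjoin to [m.+1] rows their weights as an extra column: the columns are
    then dependent, and expanding the vanishing determinant along the new
    column gives the identity. *)
Lemma koszul_boundary_rows_det L :
  size L = m.+1 -> koszul_boundary weight rows_det L = 0.
Proof.
move=> size_L; rewrite (koszul_boundary_sum _ _ 0 size_L).
pose A : 'M[R]_m.+1 := \matrix_(i, k)
  if unlift ord0 k is Some l then nth 0 L i 0 l else weight (nth 0 L i).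
pose z : 'cV[R]_m.+1 := \col_k if unlift ord0 k is Some l then - x l 0 else 1.
have Az0 : A *m z = 0.
  apply/colP => i; rewrite mxE big_ord_recl !mxE unlift_none mulr1.
  under eq_bigr do rewrite !mxE liftK mulrN.
  by rewrite sumrN /weight mxE subrr.
have detA0 : \det A = 0.
  have := congr1 (fun v : 'cV_m.+1 => v 0 0) (mul_scalar_mx (\det A) z).
  by rewrite -mul_adj_mx -mulmxA Az0 mulmx0 !mxE unlift_none mulr1.
rewrite -[RHS]detA0 (expand_det_col _ ord0); apply: eq_bigr => i _.
rewrite mulrCA /cofactor addn0 !mxE unlift_none; congr (_ * (_ * \det _)).
apply/matrixP => k l; rewrite !mxE liftK nth_cat size_takel; last first.
  by rewrite size_L ltnW.
rewrite /= /bump; case: ltnP => [lt_ki|le_ik]; first by rewrite nth_take.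
by rewrite nth_drop addSn subnKC.
Qed.

Section Regular.
Variables (u c : seq 'rV[R]_m) (j : nat).
Hypotheses (u0 : forall b, b \in u -> weight b = 0) (size_u : (size u + j = m)%N).
Hypothesis lt_jc : (j < size c)%N.
Let Y k : set R := ideal_span (take k (map weight c)).
Hypothesis c_reg : weakly_regular (map weight c).

(** Descending induction on [k], with [y_k] for the weight of the [k]-th row
    [c_k] of [c], and [bd] for the Koszul boundary. Put
    [F s = rows_det (u ++ take k c ++ c_k :: s)]. By [koszul_boundary_rows_det],
    [y_k * rows_det (u ++ take k c ++ s) = bd F s] modulo [Y k], because the rows
    of [u ++ take k c] have weight in [Y k]. By induction
    [F = bd d + y_k * d'] modulo [Y k], so that [bd F = y_k * bd d'], and [y_k]
    can be cancelled. For [k = j.+1] there is no word [s] to consider. *)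
Lemma regular_rows_det_boundary e k : (e + k = j.+1)%N ->
  exists d, forall s, (size s + k = j)%N ->
    Y k (rows_det (u ++ take k c ++ s) - koszul_boundary weight d s).
Proof.
have idY k' : is_ideal (Y k') by apply: ideal_gen_ideal.
elim: e k => [|e IH] k.
  rewrite add0n => ->; exists (fun=> 0) => s /eqP.
  by rewrite addnS eqn_leq ltnNge leq_addl.
rewrite addSnnS => /[dup] /IH[d Hd] Ek.
have lt_kc : (k < size c)%N.
  by apply: leq_ltn_trans lt_jc; rewrite -ltnS -Ek leq_addl.
pose y := (map weight c)`_k.
have size_y : (k < size (map weight c))%N by rewrite size_map.
pose F s := rows_det ((u ++ take k c) ++ nth 0 c k :: s).
have /choice[d' Hd'] s : exists a, (size s + k.+1 = j)%N ->
    Y k (F s - koszul_boundary weight d s - y * a).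
  have [Es|nEs] := eqVneq (size s + k.+1)%N j; last first.
    by exists 0 => /eqP; rewrite (negPf nEs).
  have := Hd s Es; rewrite /Y (take_nth 0 size_y) => /ideal_span_rcons[a Ha].
  exists a => _; move: Ha; rewrite mulrC /F (take_nth 0 lt_kc) -cats1.
  by rewrite -!catA.
exists d' => s Es; apply: (c_reg size_y).
have Yv b : b \in u ++ take k c -> Y k (weight b).
  rewrite mem_cat => /orP[/u0 ->|cb]; first exact: (ideal0 (idY k)).
  by apply: ideal_gen_mem; rewrite /= -map_take map_f.
have : Y k (koszul_boundary weight
    (fun s' => rows_det ((u ++ take k c) ++ s')) (nth 0 c k :: s)).
  apply: koszul_boundary_cat Yv _ => //.
  rewrite koszul_boundary_rows_det; first exact: (ideal0 (idY k)).
  by rewrite !size_cat size_takel ?(ltnW lt_kc) //= addnS -addnA [(k + _)%N]addnC Es size_u.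
rewrite /= -(nth_map _ 0) // -/y -catA -/F => HF.
have : Y k (koszul_boundary weight
    (fun s' => F s' - koszul_boundary weight d s' - y * d' s') s).
  apply: koszul_boundary_mem => // s' Es'; apply: Hd'.
  by rewrite addnS -addSn Es'.
rewrite !koszul_boundaryB koszul_boundary_boundary subr0 koszul_boundaryZ => HF'.
by have := idealD (idY k) HF HF'; rewrite addrA subrK -mulrBr.
Qed.

Lemma regular_rows_det (I : set R) s : is_ideal I -> (forall b, I (weight b)) ->
  (size s = j)%N -> I (rows_det (u ++ s)).
Proof.
move=> idI Iw Es; have [d Hd] := regular_rows_det_boundary (addn0 j.+1).
have := Hd s; rewrite addn0 /Y !take0 ideal_span_nil => /(_ Es) /eqP.
by rewrite subr_eq0 => /eqP ->; apply: koszul_boundary_weight.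
Qed.

End Regular.
End KoszulCycles.

Section RelationMinors.
Variable R : comPzRingType.

Lemma injective_complement t j (g : 'I_t -> 'I_(t + j)) : injective g ->
  exists2 h : 'I_j -> 'I_(t + j), injective h & forall i k, g i != h k.
Proof.
move=> injg; pose A := (~: [set g i | i in [set: 'I_t]])%SET.
have card_A : #|A| = j.
  by rewrite cardsCs finset.setCK card_ord card_imset // cardsT card_ord addKn.
exists (fun k => enum_val (cast_ord (esym card_A) k)).
  by apply: inj_comp; [apply: enum_val_inj|apply: cast_ord_inj].
move=> i k; apply/eqP => E; have := enum_valP (cast_ord (esym card_A) k).
by rewrite -E !inE imset_f ?inE.
Qed.

(** Completing [W] by the unit rows outside the columns of a minor gives a
    square matrix whose determinant divides the minor, and that determinant is
    in [I] by [regular_rows_det]. *)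
Lemma relations_minors (I : set R) m (x : 'cV[R]_m) t j n (A : 'M[R]_(n, m)) c :
  is_ideal I -> generators I x -> A *m x = 0 -> (t + j = m)%N ->
  (j < size c)%N ->
  weakly_regular (map (weight x) c) ->
  minors_ideal t A `<=` I.
Proof.
move=> idI Ix Ax0 Em lt_jc c_reg; case: m / Em in x A c Ix Ax0 lt_jc c_reg *.
apply: ideal_gen_sub => // _ [f [g [_ homg ->]]].
have inj_g : injective g.
  move=> i k El; apply/val_inj; case: (ltngtP i k) => // /homg;
  by rewrite El ltnn.
have [h inj_h gh] := injective_complement inj_g.
pose E : 'M[R]_(j, t + j) := rowsub h 1%:M.
pose P : 'M[R]_(t + j) := row_mx (colsub g 1%:M) (colsub h 1%:M).
pose V := rowsub f A.
have -> : \det (mxsub f g A) = \det (col_mx V E *m P).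
  have -> : col_mx V E *m P = block_mx (colsub g V) (colsub h V) 0 1%:M.
    rewrite mul_col_row !mulmx_colsub !mulmx1; congr block_mx.
      by apply/matrixP => i k; rewrite !mxE eq_sym (negPf (gh _ _)).
    by apply/matrixP => i k; rewrite !mxE (inj_eq inj_h).
  rewrite det_ublock det1 mulr1; congr (\det _).
  by apply/matrixP => i k; rewrite !mxE.
rewrite det_mulmx; apply: (idealMr idI).
pose u := [seq row i V | i <- enum 'I_t].
pose s := [seq row i E | i <- enum 'I_j].
have <- : rows_det (u ++ s) = \det (col_mx V E).
  congr (\det _); apply/row_matrixP => i; rewrite rowK nth_cat size_map size_enum_ord.
  case: (split_ordP i) => k ->.
    by rewrite rowKu /= (nth_map k) ?size_enum_ord // nth_ord_enum.
  rewrite /= addKn rowKd (nth_map k) ?size_enum_ord //.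
  by rewrite nth_ord_enum.
apply: (@regular_rows_det _ _ x u c j) => //.
- move=> _ /mapP[i _ ->]; rewrite /weight -row_mul.
  have -> : V *m x = rowsub f (A *m x) by rewrite -mul_rowsub_mx.
  by rewrite Ax0 !mxE.
- by rewrite size_map size_enum_ord.
- by move=> b; apply/Ix; exists b.
by rewrite size_map size_enum_ord.
Qed.

End RelationMinors.

(** * The Fitting ideals of an ideal *)

Theorem theorem1p1 (R : comPzRingType) (R_noeth : noetherian R)
    (I : ideal R) (m : nat) (I_gen : generated_by I m) :
  (forall j : nat, (1 <= j <= m)%N ->
     ideal_pow I (m - j) `<=` Fitt j (ideal_module I) /\
     ((exists s : seq R, [/\ size s = m, regular_seq s & (I : set R) = ideal_span s])
      \/ (local_with_maximal_ideal I /\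
          forall n : nat, generated_by I n -> (m <= n)%N) ->
      ideal_pow I (m - j) = Fitt j (ideal_module I)))
  /\
  (forall j : nat, has_grade I j.+1 -> Fitt j (ideal_module I) `<=` I).
Proof.
have idI := idealP I.
have powF n (x : 'cV_n) j : generators I x -> (1 <= j <= n)%N ->
    ideal_pow I (n - j) `<=` Fitt j (ideal_module I).
  move=> Ix /andP[j_gt0 le_jn]; have [s [A [relA FA]]] := Fitt_ideal R_noeth Ix.
  rewrite FA; apply: (ideal_pow_sub Ix) => [|h]; first exact: minors_ideal_is_ideal.
  apply: (koszul_minor (x := x)) => [v|]; first by move/relA.
  by rewrite ltn_subrL j_gt0 (leq_trans j_gt0).
have Fpow n (x : 'cV_n) j : generators I x ->
    (forall v : 'rV_n, v *m x = 0 -> forall i, ideal_set I (v 0 i)) ->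
    Fitt j (ideal_module I) `<=` ideal_pow I (n - j).
  move=> Ix relI; have [s [A [relA ->]]] := Fitt_ideal R_noeth Ix.
  apply: minors_ideal_pow => i k; have -> : A i k = row i A 0 k by rewrite mxE.
  by apply: relI; apply/relA; exists (delta_mx 0 i); rewrite -rowE.
have [x Ix] : exists x : 'cV_m, generators I x.
  case: I_gen => g <- ->; by exists (\col_i g`_i); apply: generators_span.
split=> [j le_j|j [s [size_s sI [s_reg _] _]]].
  split=> [|hyp]; first exact: (powF _ x).
  apply/seteqP; split; first exact: (powF _ x).
  case: hyp => [[s [size_s [s_reg _] Is]]|[Iloc min_m]]; last first.
    by apply: (Fpow _ x) => //; apply: local_minimal_relations.
  rewrite -size_s; apply: (Fpow _ (\col_i s`_i)).
    by rewrite Is; apply: generators_span.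
  move=> v vs0 i; rewrite Is; pose c k := oapp (v 0) 0 (insub k).
  have -> : v 0 i = c i by rewrite /c valK.
  apply: (regular_relations s_reg) => //.
  have vs00 : (v *m \col_i s`_i) 0 0 = 0 by rewrite vs0 mxE.
  by rewrite -[RHS]vs00 mxE; apply: eq_bigr => k _; rewrite mxE /c valK.
have [r [A [relA ->]]] := Fitt_ideal R_noeth Ix.
have /choice[lift_I Hlift] a : exists v : 'rV_m, ideal_set I a -> weight x v = a.
  have [Ia|nIa] := pselect (ideal_set I a); last by exists 0.
  by have [v ->] := (Ix a).1 Ia; exists v.
have Es : map (weight x) (map lift_I s) = s.
  by rewrite -map_comp -[RHS]map_id; apply/eq_in_map => a sa; apply: Hlift; apply: sI.
(* For [m < j] only the first [m.+1] terms of the sequence are used. *)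
apply: (@relations_minors _ I m x (m - j) (minn j m) r A (map lift_I s)) => //.
- apply/row_matrixP => i; rewrite row_mul row0; apply/relA.
  by exists (delta_mx 0 i); rewrite -rowE.
- by rewrite minnC minnE subnKC // leq_subr.
- by rewrite size_map size_s ltnS geq_minl.
by rewrite Es.
Qed.
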